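(* Let $G=(V,E)$ be a connected simple graph with mixed metric dimension $\beta_M(G)$, diameter $D$ and maximum degree $\Delta(G)$. Then $|V|+|E|\leq D^{\beta_M(G)}+\beta_M(G)\,(\Delta(G)+1)$.
   Context: For vertices $u,v$, $d(u,v)$ is the number of edges on a shortest $u$–$v$ path. For a vertex $w$ and an edge $e=uv$, $d(w,e)=\min(d(w,u),d(w,v))$. A vertex $w$ resolves two elements $x,y\in V\cup E$ if $d(w,x)\neq d(w,y)$. A set $S\subseteq V$ is a mixed resolving set if every pair of distinct elements of $V\cup E$ is resolved by some element of $S$. The mixed metric dimension $\beta_M(G)$ is the minimum cardinality of a mixed resolving set of $G$. The diameter is $D=\max_{u,v\in V} d(u,v)$. *)

(* Defs.v *)
From mathcomp Require Import all_boot.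

Set Implicit Arguments.
Unset Strict Implicit.
Unset Printing Implicit Defensive.

(* A finite simple graph is a symmetric irreflexive relation [e] on a finite
   vertex type [T]; an edge is the two-element set of its end points. *)
Section Graph.

Variables (T : finType) (e : rel T).

Definition edges : {set {set T}} :=
  [set [set p.1; p.2] | p : T * T & e p.1 p.2].

Definition is_connected : Prop := 0 < #|T| /\ forall u v, connect e u v.

Definition degree (v : T) : nat := #|[set u | e v u]|.

Definition max_degree : nat := \max_(v : T) degree v.

Definition has_path (u v : T) (n : nat) : bool :=
  [exists p : n.-tuple T,
    [&& path e u p, uniq (u :: p) & last u p == v]].

(* The least [n] such that some path from [u] to [v] has [n] edges.  Paths have
   fewer than [#|T|] edges; the value is [#|T|] when there is none. *)
Definition dist (u v : T) : nat := find (has_path u v) (iota 0 #|T|).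

Definition diameter : nat := \max_(u : T) \max_(v : T) dist u v.

(* [#|T|] bounds all distances, so it is neutral for this minimum
   (see [edge_dist2]). *)
Definition edge_dist (w : T) (a : {set T}) : nat :=
  \big[minn/#|T|]_(u in a) dist w u.

(* The disjoint union of the vertices and the edges. *)
Definition element : finType := (T + {a : {set T} | a \in edges})%type.

Definition elt_dist (w : T) (x : element) : nat :=
  match x with
  | inl v => dist w v
  | inr a => edge_dist w (val a)
  end.

Definition resolves (w : T) (x y : element) : bool :=
  elt_dist w x != elt_dist w y.

Definition mixed_resolving (S : {set T}) : bool :=
  [forall x : element, forall y : element,
    (x != y) ==> [exists w in S, resolves w x y]].

(* The whole vertex set, which [arg min] uses as its starting point, is mixed
   resolving (see [mixed_resolvingT]). *)
Definition mixed_metric_dim : nat :=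
  #|[arg min_(S < [set: T] | mixed_resolving S) #|S|]|.

Lemma dist_le u v : dist u v <= #|T|.
Proof. by rewrite -[leqRHS](size_iota 0) find_size. Qed.

Lemma edge_dist2 w u v : edge_dist w [set u; v] = minn (dist w u) (dist w v).
Proof.
apply/eqP; rewrite eqn_leq; apply/andP; split.
  have le_edge (x : T) (a : {set T}) : x \in a -> edge_dist w a <= dist w x.
    move=> xa; rewrite /edge_dist; have := mem_index_enum x.
    elim: (index_enum T) => // y s IHs; rewrite inE big_cons.
    case/predU1P => [<-|/IHs le_x]; first by rewrite xa geq_minl.
    by case: ifP => // _; rewrite geq_min le_x orbT.
  by rewrite leq_min !le_edge // !inE eqxx ?orbT.
rewrite /edge_dist; apply: (big_ind (leq _)) => [|x y|x /set2P[]->].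
- by rewrite geq_min dist_le.
- by rewrite [minn x y]/minn; case: ifP.
- exact: geq_minl.
exact: geq_minr.
Qed.

Lemma has_path0 u v : has_path u v 0 = (u == v).
Proof.
apply/existsP/eqP => [[p]|->]; first by rewrite tuple0 => /andP[_ /eqP].
by exists [tuple]; rewrite /= !eqxx.
Qed.

Lemma dist_eq0 u v : (dist u v == 0) = (u == v).
Proof.
have T_gt0 : 0 < #|T| by apply/card_gt0P; exists u.
rewrite /dist; case: #|T| T_gt0 => [|n _] //.
by rewrite [iota _ _]/= [find _ _]/= has_path0; case: (u == v).
Qed.

Lemma edge_dist_eq0 w a : a \in edges -> (edge_dist w a == 0) = (w \in a).
Proof.
case/imsetP=> -[u v] _ -> /=; rewrite edge_dist2 !inE -!dist_eq0.
by case: (dist w u) (dist w v) => [|m] [|n]; rewrite ?min0n ?minn0 ?minnSS.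
Qed.

Lemma mixed_resolvingT : symmetric e -> irreflexive e ->
  mixed_resolving [set: T].
Proof.
move=> symE irrE.
have VE v (a : {set T}) : a \in edges ->
    [exists w in [set: T], dist w v != edge_dist w a].
  move=> aE; suff [w ne_w] : exists w, (w == v) != (w \in a).
    apply/existsP; exists w; rewrite inE /=.
    by apply: contra ne_w => /eqP ed; rewrite -dist_eq0 -(edge_dist_eq0 w aE) ed.
  have [va|/negPf va] := boolP (v \in a); last by exists v; rewrite va eqxx.
  case/imsetP: aE va => -[x y]; rewrite inE /= => exy -> vxy.
  have neq_xy : x != y by apply: contraTneq exy => ->; rewrite irrE.
  case/set2P: vxy => ->; [exists y | exists x]; rewrite !inE eqxx ?orbT.
    by rewrite (eq_sym y) (negPf neq_xy).
  by rewrite (negPf neq_xy).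
apply/forallP=> x; apply/forallP=> y; apply/implyP.
case: x y => [u|[a aE]] [v|[b bE]] neq /=.
- apply/existsP; exists u; rewrite inE /resolves /=.
  have -> : dist u u = 0 by apply/eqP; rewrite dist_eq0.
  by rewrite eq_sym dist_eq0; apply: contra neq => /eqP->.
- exact: VE.
- by have /existsP[w] := VE v a aE; rewrite eq_sym => ?; apply/existsP; exists w.
have /existsP[w ne_w] : [exists w, (w \in a) != (w \in b)].
  rewrite -negb_forall; apply: contra neq => /forallP eq_ab.
  apply/eqP; congr inr; apply: val_inj; apply/setP=> w; exact/eqP.
apply/existsP; exists w; rewrite inE /resolves /=.
by apply: contra ne_w => /eqP ed; rewrite -!edge_dist_eq0 // ed.
Qed.

End Graph.

(* Main.v *)
Require Import Defs.
From mathcomp Require Import all_boot.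

(** Let [S] be a minimum mixed resolving set.  An element at distance [0] from
    some [s] in [S] is [s] itself or an edge incident to [s]: there are at most
    [#|S| * (max_degree e + 1)] of them.  All other elements have distances in
    [1 .. diameter e] to each vertex of [S], and these distances determine the
    element: there are at most [diameter e ^ #|S|] of them. *)

Section Graph.

Context {T : finType} {e : rel T}.

Lemma dist_le_diameter u v : dist e u v <= diameter e.
Proof. by apply: (bigmax_sup u) => //; apply: (bigmax_sup v). Qed.

Lemma elt_dist_le_diameter w (x : element e) : elt_dist w x <= diameter e.
Proof.
case: x => [v|[_ /= /imsetP[[u v] _ ->]]]; first exact: dist_le_diameter.
by rewrite /= edge_dist2 geq_min dist_le_diameter.
Qed.

(** Every edge at [w] is [[set w; u]] for a neighbour [u]; symmetry handles the case where [w] is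
    the second end. *)
Lemma card_incident_edges (e_sym : symmetric e) w :
  #|[set a in edges e | w \in a]| <= degree e w.
Proof.
apply: leq_trans (leq_imset_card (fun u => [set w; u]) [set u | e w u]).
apply/subset_leq_card/subsetP => a; rewrite inE => /andP[/imsetP[[u v]]].
rewrite inE /= => e_uv -> /set2P[]->; apply/imsetP.
  by exists v; rewrite ?inE.
by exists u; rewrite ?inE 1?e_sym // setUC.
Qed.

Lemma card_elt_dist_eq0 (e_sym : symmetric e) w :
  #|[set x : element e | elt_dist w x == 0]| <= max_degree e + 1.
Proof.
pose edge_elts := [set x : {a | a \in edges e} | w \in val x].
have sub : [set x : element e | elt_dist w x == 0] \subset
    inl w |: [set inr x | x in edge_elts].
  apply/subsetP=> -[v|[a aE]]; rewrite !inE /=.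
    by rewrite dist_eq0 => /eqP->; rewrite eqxx.
  by rewrite edge_dist_eq0 // => wa; rewrite imset_f ?inE.
apply: leq_trans (subset_leq_card sub) _.
rewrite addnC; apply: leq_trans (leq_card_setU _ _) _.
rewrite cards1 leq_add2l (leq_trans (leq_imset_card _ _)) //.
(* Forgetting the proof of membership in [edges e] loses no element, so the edges may be counted as
   plain sets. *)
rewrite -(card_imset _ val_inj).
apply: leq_trans (leq_trans (card_incident_edges e_sym w) (leq_bigmax w)).
apply/subset_leq_card/subsetP => _ /imsetP[[a aE] wa ->].
by move: wa; rewrite !inE aE.
Qed.

Lemma card_elt_dist_gt0 (S : {set T}) : mixed_resolving e S ->
  #|[set x : element e | [forall w in S, elt_dist w x != 0]]|
    <= diameter e ^ #|S|.
Proof.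
move=> /forallP res; set far := [set x | _].
(* The vector of distances to [S], padded with [ord0] outside [S] so that its support lies in
   [S]. *)
pose code (x : element e) : {ffun T -> 'I_(diameter e).+1} :=
  [ffun w => if w \in S then inord (elt_dist w x) else ord0].
have codeE w x : w \in S -> code x w = elt_dist w x :> nat.
  by move=> wS; rewrite ffunE wS inordK // ltnS elt_dist_le_diameter.
have code_inj : injective code.
  move=> x y eq_code; apply/eqP; apply: contraT => neq_xy.
  have /forallP/(_ y)/implyP/(_ neq_xy)/exists_inP[w wS] := res x.
  by rewrite /resolves -!codeE // eq_code eqxx.
(* The base [diameter e] is read as the number of nonzero values in ['I_(diameter e).+1]; the power
   then counts the functions that are nonzero on [S] and [ord0] elsewhere. *)
rewrite -(card_imset _ code_inj) -[diameter e in leqRHS]/(_.+1.-1).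
rewrite -[in leqRHS](card_ord (diameter e).+1) -(cardC1 ord0).
rewrite -(card_pffun_on ord0).
apply/subset_leq_card/subsetP => _ /imsetP[x x_far ->].
apply/pffun_onP; split=> [|_ /imageP[w wS ->]].
  by apply/subsetP=> w; rewrite inE ffunE; case: ifP; rewrite ?eqxx.
move: x_far; rewrite !inE => /forall_inP/(_ w wS).
by rewrite -codeE.
Qed.

Lemma card_element : #|element e| = #|T| + #|edges e|.
Proof. by rewrite card_sum card_sig. Qed.

Lemma card_element_le (e_sym : symmetric e) (S : {set T}) :
  mixed_resolving e S ->
  #|T| + #|edges e| <= diameter e ^ #|S| + #|S| * (max_degree e + 1).
Proof.
move=> res; rewrite -card_element.
rewrite -(cardsC [set x : element e | [forall w in S, elt_dist w x != 0]]).
apply: leq_add (card_elt_dist_gt0 _ res) _.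
have sub : ~: [set x : element e | [forall w in S, elt_dist w x != 0]]
    \subset \bigcup_(w in S) [set x : element e | elt_dist w x == 0].
  apply/subsetP=> x; rewrite !inE negb_forall_in => /exists_inP[w wS].
  by rewrite negbK => x0; apply/bigcupP; exists w; rewrite ?inE.
apply: leq_trans (subset_leq_card sub) _.
rewrite -sum_nat_const.
(* Union bound over [S], then the bound for each single vertex. *)
apply: (@leq_trans (\sum_(w in S) #|[set x : element e | elt_dist w x == 0]|)).
  elim/big_rec2: _ => [|w n A _ leA]; first by rewrite cards0.
  by rewrite (leq_trans (leq_card_setU _ _)) ?leq_add2l.
by apply: leq_sum => w _; apply: card_elt_dist_eq0.
Qed.

End Graph.

Theorem theorem4 (T : finType) (e : rel T)
    (e_sym : symmetric e) (e_irr : irreflexive e) (e_conn : is_connected e) :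
  #|T| + #|edges e|
    <= diameter e ^ mixed_metric_dim e
       + mixed_metric_dim e * (max_degree e + 1).
Proof.
rewrite /mixed_metric_dim; case: arg_minnP => [|S res _].
  (* The starting point of [arg min] has to be mixed resolving. *)
  exact: mixed_resolvingT.
exact: card_element_le.
Qed.
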